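(* Let $X$ be a Banach space which is non-reflexive. Assume that either (i) $X$ coarsely, or uniformly, embeds into an upper stable metric space, or (ii) the unit ball of $X$ uniformly embeds into an upper stable metric space. Then $X$ contains the $\ell_1^n$'s.
   Context: For a set $M\subseteq\mathbb{N}$ and $k\ge0$, $[M]^k$ is the set of $k$-element subsets of $M$, written as increasing tuples $\bar n=(n_1,\dots,n_k)$, $n_1<\dots<n_k$; $[k]=\{1,\dots,k\}$. Upper stability: a metric space $(Y,d_Y)$ is $K_u$-upper stable ($K_u>0$) if for every $k\ge1$, every $1\le\ell\le k$, every permutation $\pi\colon[k]\to[k]$ which preserves the order on $\{1,\dots,\ell\}$ and on $\{\ell+1,\dots,k\}$, all bounded maps $f\colon[\mathbb{N}]^\ell\to Y$ and $g\colon[\mathbb{N}]^{k-\ell}\to Y$, and every infinite $M\subseteq\mathbb{N}$, $$\inf_{\bar n\in[M]^k}d_Y\big(f(n_1,\dots,n_\ell),g(n_{\ell+1},\dots,n_k)\big)\le K_u\sup_{\bar n\in[M]^k}d_Y\big(f(n_{\pi(1)},\dots,n_{\pi(\ell)}),g(n_{\pi(\ell+1)},\dots,n_{\pi(k)})\big).$$ It is upper stable if it is $K_u$-upper stable for some $K_u>0$. Embeddings: for a map $\varphi\colon(A,d_A)\to(Y,d_Y)$ between metric spaces let $\rho_\varphi(t)=\inf\{d_Y(\varphi(x),\varphi(y)): d_A(x,y)\ge t\}$ and $\omega_\varphi(t)=\sup\{d_Y(\varphi(x),\varphi(y)): d_A(x,y)\le t\}$. The map $\varphi$ is a coarse embedding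 if $\lim_{t\to\infty}\rho_\varphi(t)=\infty$ and $\omega_\varphi(t)<\infty$ for all $t>0$; it is a uniform embedding if $\lim_{t\to0}\omega_\varphi(t)=0$ and $\rho_\varphi(t)>0$ for all $t>0$. ''$X$ contains the $\ell_1^n$'s'' means that $X$ contains almost isometric copies of $\ell_1^n$ for all $n\ge1$: for every $n\ge1$ and $\varepsilon>0$ there is an $n$-dimensional subspace of $X$ that is $(1+\varepsilon)$-linearly isomorphic to $\ell_1^n$. *)

(* Defs.v *)
From HB Require Import structures.
From mathcomp Require Import all_boot all_order all_algebra perm.
From mathcomp Require Import all_classical all_reals all_analysis.
Set Implicit Arguments.
Unset Strict Implicit.
Unset Printing Implicit Defensive.
Import Order.TTheory GRing.Theory Num.Theory.
Import numFieldNormedType.Exports.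
Local Open Scope classical_set_scope.
Local Open Scope ring_scope.

(* The set [M]^k of k-element subsets of M, as increasing tuples. *)
Definition incr_tuples (M : set nat) (k : nat) : set (k.-tuple nat) :=
  [set n : k.-tuple nat | sorted ltn n /\ forall i, M (tnth n i)].
Arguments incr_tuples : clear implicits.

Definition bounded_map_on (R : realType) (T : Type) (Y : metricType R)
    (A : set T) (f : T -> Y) : Prop :=
  exists r : R, forall s t, A s -> A t -> mdist (f s) (f t) <= r.

(* Here k = l + m, and the two blocks of indices {1, ..., l} and
   {l + 1, ..., k} are the images of [lshift m] and [rshift l].
   A map on [N]^l is represented by a map on all l-tuples: its values outside
   the increasing tuples occur neither in the boundedness assumptions nor in
   the conclusion, as [pi] is increasing on each block.
   The infimum and supremum are taken in the extended reals; by boundedness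
   of f and g, and since M is infinite, they are both finite. *)
Definition K_upper_stable (R : realType) (K : R) (Y : metricType R) : Prop :=
  forall (l m : nat) (pi : 'S_(l + m)),
    (1 <= l)%N ->
    (forall i j : 'I_l, (i < j)%N -> (pi (lshift m i) < pi (lshift m j))%N) ->
    (forall i j : 'I_m, (i < j)%N -> (pi (rshift l i) < pi (rshift l j))%N) ->
  forall (f : l.-tuple nat -> Y) (g : m.-tuple nat -> Y),
    bounded_map_on (incr_tuples setT l) f ->
    bounded_map_on (incr_tuples setT m) g ->
  forall M : set nat, infinite_set M ->
    (ereal_inf [set (mdist (f [tuple tnth n (lshift m i) | i < l])
                           (g [tuple tnth n (rshift l j) | j < m]))%:E
               | n in incr_tuples M (l + m)]
     <= K%:E *
       ereal_sup [set (mdist (f [tuple tnth n (pi (lshift m i)) | i < l])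
                             (g [tuple tnth n (pi (rshift l j)) | j < m]))%:E
                 | n in incr_tuples M (l + m)])%E.

Definition upper_stable (R : realType) (Y : metricType R) : Prop :=
  exists K : R, 0 < K /\ K_upper_stable K Y.

(* The moduli of the restriction of phi to D, where D carries the metric
   induced by the norm of X. *)
Definition compression_modulus (R : realType) (X : normedModType R)
    (Y : metricType R) (D : set X) (phi : X -> Y) (t : R) : \bar R :=
  ereal_inf [set (mdist (phi p.1) (phi p.2))%:E
            | p in [set p : X * X | [/\ D p.1, D p.2 & t <= `|p.1 - p.2| ]]].

Definition expansion_modulus (R : realType) (X : normedModType R)
    (Y : metricType R) (D : set X) (phi : X -> Y) (t : R) : \bar R :=
  ereal_sup [set (mdist (phi p.1) (phi p.2))%:E
            | p in [set p : X * X | [/\ D p.1, D p.2 & `|p.1 - p.2| <= t ]]].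

Definition coarse_embedding (R : realType) (X : normedModType R)
    (Y : metricType R) (D : set X) (phi : X -> Y) : Prop :=
  (compression_modulus D phi t @[t --> +oo%R] --> +oo%E) /\
  (forall t : R, 0 < t -> (expansion_modulus D phi t < +oo)%E).

Definition uniform_embedding (R : realType) (X : normedModType R)
    (Y : metricType R) (D : set X) (phi : X -> Y) : Prop :=
  (expansion_modulus D phi t @[t --> (0 : R)^'+] --> 0%E) /\
  (forall t : R, 0 < t -> (0 < compression_modulus D phi t)%E).

Definition coarsely_embeds (R : realType) (X : normedModType R) (D : set X)
    (Y : metricType R) : Prop :=
  exists phi : X -> Y, coarse_embedding D phi.

Definition uniformly_embeds (R : realType) (X : normedModType R) (D : set X)
    (Y : metricType R) : Prop :=
  exists phi : X -> Y, uniform_embedding D phi.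

Definition unit_ball (R : realType) (X : normedModType R) : set X :=
  [set x | `|x| <= 1].
Arguments unit_ball {R} X.

Definition dual (R : realType) (X : normedModType R) : set (X -> R) :=
  [set f : X -> R | scalar f /\ continuous f].
Arguments dual {R} X.

Definition dual_norm (R : realType) (X : normedModType R) (f : X -> R) :
    \bar R :=
  ereal_sup [set `|f x|%:E | x in unit_ball X].

(* An element of X** is a map on [dual X]; it is represented by a map on all
   functions X -> R, whose values outside [dual X] are irrelevant. *)
Definition bidual (R : realType) (X : normedModType R) : set ((X -> R) -> R) :=
  [set Phi : (X -> R) -> R |
    (forall (a : R) (f g : X -> R), dual X f -> dual X g ->
       Phi (fun x => a * f x + g x) = a * Phi f + Phi g) /\
    (exists C : R, forall f, dual X f ->
       (`|Phi f|%:E <= C%:E * dual_norm f)%E)].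
Arguments bidual {R} X.

(* The canonical embedding of X into X** is onto. *)
Definition reflexive_space (R : realType) (X : normedModType R) : Prop :=
  forall Phi, bidual X Phi ->
    exists x : X, forall f, dual X f -> Phi f = f x.

Definition l1_norm (R : realType) (n : nat) (v : 'rV[R]_n) : R :=
  \sum_(i < n) `|v ord0 i|.

(* The subspace is the range of T, which is n-dimensional since the last
   inequality makes T injective; a and b bound the operator norms of T and of
   its inverse from the range of T onto l_1^n. *)
Definition contains_l1_copy (R : realType) (X : normedModType R) (n : nat)
    (C : R) : Prop :=
  exists (T : {linear 'rV[R]_n -> X}) (a b : R),
    [/\ 0 <= a, 0 <= b, a * b <= C,
        forall v, `|T v| <= a * l1_norm v
      & forall v, l1_norm v <= b * `|T v| ].
Arguments contains_l1_copy {R} X n C.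

Definition contains_l1ns (R : realType) (X : normedModType R) : Prop :=
  forall (n : nat) (e : R), (1 <= n)%N -> 0 < e ->
    contains_l1_copy X n (1 + e).

(* Main.v *)
Require Import Defs.
From HB Require Import structures.
From mathcomp Require Import all_boot all_order all_algebra perm.
From mathcomp Require Import all_classical all_reals all_analysis.
From mathcomp Require Import ring lra.
Set Implicit Arguments.
Unset Strict Implicit.
Unset Printing Implicit Defensive.
Import Order.TTheory GRing.Theory Num.Theory.
Import numFieldNormedType.Exports.
Local Open Scope classical_set_scope.
Local Open Scope ring_scope.

(** If X is not reflexive, some Phi in its bidual is at positive distance from
    X. As in James's characterization of reflexivity, Phi yields a sequence x_n
    in the unit ball and theta > 0 such that the sum of any k terms differs from
    the sum of any k later terms by at least theta k in norm
    ([james_sequence]). The tools are the existence of norming functionals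
    ([norming_functional]) and the approximation of Phi on finitely many
    functionals by elements of a ball of X ([helly]).

    Suppose that X does not contain the l_1^n's. Then for every e > 0 there are
    k and a subsequence along which all the alternating sums
    x_{n_1} - x_{n_2} + ... - x_{n_{2k}} have norm at most e k
    ([small_alt_sums]). Let indeed c be the infimum of the r such that, for
    arbitrarily large k, some subsequence has all its alternating sums of 2 k
    terms bounded by r k, and assume c > 0. Fix n, and take a large k such that
    on some subsequence the alternating sums of 2 k terms are at most (c + d) k;
    by Ramsey's theorem ([ramsey]), on a further subsequence those of
    2 n (k - 1) terms exceed (c - d) n (k - 1). Let u_1, ..., u_n be the
    alternating sums over n consecutive blocks of 2 k indices. Removing the
    first two indices of a block, or, if its sign is negative, the first and
    the last one, turns any signed sum of the u_j into a single alternating sum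
    of 2 n (k - 1) terms, and changes it by at most 2 n. Thus all the signed
    sums of the u_j have norm almost n c k, while each u_j has norm at most
    (c + d) k, so that the u_j span an almost isometric copy of l_1^n
    ([l1_copy]).

    Finally, let F be an embedding into an upper stable space, and apply upper
    stability to the images under F of scaled sums of k terms, with the
    permutation that interlaces the two blocks of indices
    ([upper_stable_sums]). Two consecutive sums differ by at least theta k, and
    two interlaced ones by at most e k. For a uniform embedding of the ball,
    the scale 1 / k bounds a fixed positive number by K times the modulus of
    expansion at e, which is absurd for small e; for a coarse embedding, the
    scale 1 / (e k) bounds the modulus of compression at theta / e by K times
    the modulus of expansion at 1, although it tends to infinity as e tends
    to 0. *)

(** * Ramsey's theorem *)

(** Strictly increasing maps. An infinite set of natural numbers is represented
    by its increasing enumeration, and its k-subsets by the images of the sorted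
    sequences of size k under that enumeration. *)
Definition incr (h : nat -> nat) : Prop := {homo h : i j / (i < j)%N}.

Lemma incr_comp g h : incr g -> incr h -> incr (g \o h).
Proof. by move=> gi hi i j ij; apply/gi/hi. Qed.

Lemma incr_addn m : incr (addn m).
Proof. by move=> i j; rewrite ltn_add2l. Qed.

Lemma incr_sorted h s : incr h -> sorted ltn (map h s) = sorted ltn s.
Proof.
move=> hi; rewrite sorted_map; apply: eq_sorted => i j /=.
exact: (leqW_mono (leq_mono hi)).
Qed.

Lemma pigeonhole (D : nat -> Prop) :
  exists2 h, incr h & (forall i, D (h i)) \/ (forall i, ~ D (h i)).
Proof.
have [[N ND]|noN] := pselect (exists N, forall i, (N <= i)%N -> ~ D i).
  exists (addn N); first exact: incr_addn.
  by right=> i; apply: ND; rewrite leq_addr.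
have next N : exists i, (N <= i)%N /\ D i.
  apply: contrapT => nD; apply: noN; exists N => i Ni Di.
  by apply: nD; exists i.
have [F /all_and2[FN FD]] := choice next.
exists (fun i => iter i (fun j => F j.+1) (F 0%N)).
  by apply: homo_ltn => [i j k|i]; [exact: ltn_trans|rewrite iterS; exact: FN].
by left; case=> [|i] /=; exact: FD.
Qed.

(** Ramsey's theorem for colourings of the k-subsets of the integers with two
    colours. *)
Lemma ramsey k (P : seq nat -> Prop) : exists2 h, incr h &
  (forall s, sorted ltn s -> size s = k -> P (map h s)) \/
  (forall s, sorted ltn s -> size s = k -> ~ P (map h s)).
Proof.
elim: k P => [|k IH] P.
  exists id => //; have [P0|P0] := pselect (P [::]); [left|right];
  by move=> s _ /size0nil ->.
(* The k-subsets s of the tail of a reservoir [g] are coloured by the colour of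
   [g 0 :: s]. *)
have step g : exists h, incr h /\
    ((forall s, sorted ltn s -> size s = k ->
        P (g 0%N :: map (fun i => g (h i).+1) s)) \/
     (forall s, sorted ltn s -> size s = k ->
        ~ P (g 0%N :: map (fun i => g (h i).+1) s))).
  have [h hi hP] := IH (fun s => P (g 0%N :: map (fun i => g i.+1) s)).
  exists h; split=> //.
  by case: hP => hP; [left|right] => s ss sk; have := hP s ss sk;
     rewrite -map_comp.
have [H /all_and2[Hi HP]] := choice step.
(* Iterating, the first element [a i] of the i-th reservoir [G i] has a colour
   that depends on [i] only, for all k-subsets of [G i.+1], which contains all
   the later [a j]. *)
pose G i := iter i (fun g j => g (H g j).+1) id.
have GS i j : G i.+1 j = G i (H (G i) j).+1 by [].
have Gi i : incr (G i).
  elim: i => [//|i Gi] m n mn; rewrite !GS; apply: Gi; rewrite ltnS.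
  exact: Hi.
pose a i := G i 0%N.
have ai : incr a.
  apply: homo_ltn => [x y z|i]; first exact: ltn_trans.
  by rewrite /a GS; exact: Gi.
have Gsub i d : exists q, forall j, G (i + d)%N j = G i (q j).
  elim: d => [|d [q Gq]]; first by rewrite addn0; exists id.
  by rewrite addnS; exists (fun j => q (H (G (i + d)%N) j).+1) => j; rewrite GS.
have asub i j : exists q, (i < j)%N -> a j = G i.+1 q.
  have [ij|//] := ltnP i j; last by exists 0%N.
  have [q Gq] := Gsub i.+1 (j - i.+1)%N.
  by exists (q 0%N) => _; rewrite -Gq subnKC.
have [Q HQ] := choice (fun p : nat * nat => asub p.1 p.2).
have tail i t : sorted ltn (i :: t) ->
    sorted ltn (map (fun j => Q (i, j)) t) /\
    map a t = map (G i.+1) (map (fun j => Q (i, j)) t).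
  move=> it; have E : map a t = map (G i.+1) (map (fun j => Q (i, j)) t).
    rewrite -map_comp; apply/eq_in_map => j jt /=.
    by apply: (HQ (i, j)); have /allP/(_ j jt) := order_path_min ltn_trans it.
  split=> //; rewrite -(incr_sorted _ (Gi i.+1)) -E incr_sorted //.
  exact: path_sorted it.
pose D i := forall s, sorted ltn s -> size s = k -> P (a i :: map (G i.+1) s).
have [h hi hD] := pigeonhole D.
exists (a \o h); first exact: incr_comp.
case: hD => hD; [left|right]; case=> [//|i t] it [tk]; rewrite map_comp /=;
  have [|ts ->] := tail (h i) (map h t); rewrite -?map_cons ?incr_sorted //.
  by apply: hD => //; rewrite !size_map.
case: (HP (G (h i))) => [HD|]; first by case: (hD i).
by apply => //; rewrite !size_map.
Qed.

(** * Hahn-Banach theorem *)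

(** Sublinear functionals. Homogeneity is only required as an inequality, the
    converse one being a consequence. *)
Definition sublinear (R : realType) (X : lmodType R) (p : X -> R) : Prop :=
  (forall x y, p (x + y) <= p x + p y) /\
  (forall a x, 0 <= a -> p (a *: x) <= a * p x).

Section hahn_banach.
Context {R : realType} {X : lmodType R}.
Implicit Types (p q : X -> R) (x y : X).

Lemma sublinear0 p : sublinear p -> p 0 = 0.
Proof.
move=> [pD pZ]; apply/eqP; rewrite eq_le; apply/andP; split.
  by have := pZ 0 0 (lexx 0); rewrite scale0r mul0r.
by have := pD 0 0; rewrite addr0; lra.
Qed.

Lemma sublinearZ p a x : sublinear p -> 0 <= a -> p (a *: x) = a * p x.
Proof.
move=> sp; rewrite le_eqVlt => /predU1P[<-|a0].
  by rewrite scale0r mul0r sublinear0.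
apply/eqP; rewrite eq_le sp.2 ?(ltW a0) //=.
rewrite -ler_pdivlMl //; have := sp.2 a^-1 (a *: x).
by rewrite scalerA mulVf ?gt_eqF // scale1r; apply; rewrite invr_ge0 ltW.
Qed.

Lemma sublinear_geN p x : sublinear p -> - p (- x) <= p x.
Proof.
by move=> sp; have := sp.1 x (- x); rewrite subrr sublinear0 //; lra.
Qed.

(** Any [p] dominates a sublinear functional whose value at [- y] is at most
    [- p y]; it is the infimum over [t >= 0] of [p (x + t y) - t p y]. *)
Lemma sublinear_shift p y : sublinear p ->
  exists q, [/\ sublinear q, forall x, q x <= p x & q (- y) <= - p y].
Proof.
move=> sp; pose E x := [set p (x + t *: y) - t * p y | t in [set t | 0 <= t]].
have Elb x : lbound (E x) (- p (- x)).
  move=> _ [t /= t0 <-]; have := sp.1 (x + t *: y) (- x).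
  by rewrite addrAC subrr add0r (sublinearZ _ sp) //; lra.
have E0 x : E x !=set0 by exists (p (x + 0 *: y) - 0 * p y), 0 => /=.
have Einf x : has_inf (E x) by split; [exact: E0|exists (- p (- x))].
have Ele x t : 0 <= t -> inf (E x) <= p (x + t *: y) - t * p y.
  by move=> t0; apply: (ge_inf (Einf x).2); exists t.
exists (fun x => inf (E x)); split; last 2 first.
- by move=> x; apply: le_trans (Ele x 0 (lexx 0)) _; rewrite scale0r mul0r addr0 subr0.
- apply: le_trans (Ele (- y) 1 ler01) _.
  by rewrite scale1r addNr mul1r (sublinear0 sp) sub0r.
split=> [x z|a x].
  rewrite /= -lerBlDr; apply: lb_le_inf; first exact: E0.
  move=> _ [t /= t0 <-]; rewrite lerBlDr -lerBlDl.
  apply: lb_le_inf; first exact: E0.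
  move=> _ [s /= s0 <-]; have := Ele (x + z) (t + s) (addr_ge0 t0 s0).
  have := sp.1 (x + t *: y) (z + s *: y).
  by rewrite addrACA -scalerDl; lra.
rewrite le_eqVlt => /predU1P[<-|a0].
  rewrite mul0r scale0r; apply: le_trans (Ele 0 0 (lexx 0)) _.
  by rewrite add0r mul0r subr0 scale0r (sublinear0 sp).
rewrite /= -ler_pdivrMl //; apply: lb_le_inf; first exact: E0.
move=> _ [t /= t0 <-]; rewrite ler_pdivrMl // mulrBr -(@sublinearZ _ a) ?(ltW a0) //.
by rewrite scalerDr scalerA mulrA; apply: Ele; rewrite mulr_ge0 // ltW.
Qed.

(** By Zorn's lemma, there are minimal sublinear functionals below [q]: the
    pointwise infimum of a chain is again sublinear. *)
Lemma sublinear_minimal q : sublinear q -> exists p,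
  [/\ sublinear p, forall x, p x <= q x &
      forall p', sublinear p' -> (forall x, p' x <= p x) ->
      forall x, p x <= p' x].
Proof.
move=> sq; pose Q p := sublinear p /\ forall x, p x <= q x.
have Qq : Q q by split.
pose T := {p : X -> R | Q p}.
pose le (p1 p2 : T) := `[< forall x, sval p2 x <= sval p1 x >].
have [||A Atot|[p [sp pq]] pmin] := @ZL_preorder T (exist Q q Qq) le.
- by move=> t; apply/asboolP.
- move=> r s t /asboolP rs /asboolP st; apply/asboolP => x.
  exact: le_trans (st x) (rs x).
- have [A0|/set0P[t0 At0]] := eqVneq A set0.
    by exists (exist Q q Qq) => s; rewrite A0.
  pose E x := [set sval t x | t in A].
  have Elb x : lbound (E x) (- q (- x)).
    move=> _ [[p [sp pq]] /= _ <-]; apply: le_trans (sublinear_geN x sp).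
    by rewrite lerN2.
  have E0 x : E x !=set0 by exists (sval t0 x), t0.
  have Ele x t : A t -> inf (E x) <= sval t x.
    by move=> At; apply: ge_inf; [exists (- q (- x))|exists t].
  have sI : sublinear (fun x => inf (E x)).
    split=> [x z|a x].
      rewrite /= -lerBlDr; apply: lb_le_inf; first exact: E0.
      move=> _ [t At <-]; rewrite lerBlDr -lerBlDl.
      apply: lb_le_inf; first exact: E0.
      move=> _ [s As <-].
      have [/asboolP st|/asboolP ts] := Atot _ _ As At.
        have := (svalP t).1.1 x z; have := st z; have := Ele (x + z) t At.
        by lra.
      have := (svalP s).1.1 x z; have := ts x; have := Ele (x + z) s As.
      by lra.
    rewrite le_eqVlt => /predU1P[<-|a0].
      rewrite mul0r scale0r; apply: le_trans (Ele 0 t0 At0) _.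
      by rewrite (sublinear0 (svalP t0).1).
    rewrite /= -ler_pdivrMl //; apply: lb_le_inf; first exact: E0.
    move=> _ [t At <-]; rewrite ler_pdivrMl //.
    by rewrite -(@sublinearZ _ a _ (svalP t).1) ?(ltW a0) //; exact: Ele.
  have Iq x : inf (E x) <= q x by apply: le_trans (Ele x _ At0) ((svalP t0).2 x).
  exists (exist Q _ (conj sI Iq)) => s As; apply/asboolP => x /=.
  exact: Ele.
- exists p; split=> // p' sp' p'p x.
  have p'q z : p' z <= q z by apply: le_trans (p'p z) (pq z).
  have /asboolP := pmin (exist Q p' (conj sp' p'q)) (asboolT p'p).
  exact.
Qed.

Lemma sublinear_minimal_scalar p : sublinear p ->
  (forall p', sublinear p' -> (forall x, p' x <= p x) ->
   forall x, p x <= p' x) -> scalar p.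
Proof.
move=> sp pmin; have pN y : p (- y) = - p y.
  have [q [sq qp qN]] := sublinear_shift y sp.
  apply/eqP; rewrite eq_le; apply/andP; split.
    exact: le_trans (pmin q sq qp _) qN.
  by have := sublinear_geN y sp; lra.
have pD x y : p (x + y) = p x + p y.
  apply/eqP; rewrite eq_le sp.1 /=; have := sp.1 (x + y) (- y).
  by rewrite addrK pN; lra.
move=> a x y; rewrite pD; congr (_ + _).
have [a0|a0] := leP 0 a; first exact: sublinearZ.
by rewrite -[a]opprK scaleNr pN (sublinearZ _ sp) ?oppr_ge0 ?(ltW a0) // !mulNr.
Qed.

End hahn_banach.

(** Hahn-Banach: every vector is normed by a functional of norm at most 1. *)
Lemma norming_functional (R : realType) (X : normedModType R) (z : X) :
  exists f : X -> R,
    [/\ scalar f, forall x, `|f x| <= `|x| & f z = `|z| ].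
Proof.
have sN : sublinear (fun x : X => `|x|).
  by split=> [x y|a x a0]; [exact: ler_normD|rewrite normrZ ger0_norm].
have [q [sq qN qz]] := sublinear_shift z sN.
have [f [sf fq fmin]] := sublinear_minimal sq.
have lf := sublinear_minimal_scalar sf fmin.
have fN x : f (- x) = - f x.
  by have := lf (-1) x 0; rewrite addr0 scaleN1r mulN1r (sublinear0 sf) addr0.
have fle x : f x <= `|x| by apply: le_trans (fq x) (qN x).
exists f; split=> //.
  by move=> x; rewrite ler_norml fle andbT lerNl -fN -normrN.
apply/eqP; rewrite eq_le fle /=.
by have := fq (- z); rewrite fN; move: qz; lra.
Qed.

(** * Functionals and Helly's theorem *)

Section scalar_functions.
Context {R : realType} {X : normedModType R}.
Implicit Types (f : X -> R) (x y : X).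

Lemma scalar_pack f : scalar f -> exists F : {scalar X}, f = F.
Proof.
move=> sf; pose M := GRing.isLinear.Build R X R *%R f sf.
by pose F : {scalar X} := HB.pack f M; exists F.
Qed.

Lemma scalarB f x y : scalar f -> f (x - y) = f x - f y.
Proof. by move=> /scalar_pack[F ->]; rewrite linearB. Qed.

Lemma scalarZl f a x : scalar f -> f (a *: x) = a * f x.
Proof. by move=> /scalar_pack[F ->]; rewrite scalarZ. Qed.

Lemma scalar_sum f (I : Type) (r : seq I) (u : I -> X) :
  scalar f -> f (\sum_(i <- r) u i) = \sum_(i <- r) f (u i).
Proof. by move=> /scalar_pack[F ->]; rewrite linear_sum. Qed.

(** The unit ball of the dual space. *)
Definition dual_ball : set (X -> R) :=
  [set f | scalar f /\ forall x, `|f x| <= `|x|].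

Lemma dual_ball_dual f : dual_ball f -> dual X f.
Proof.
move=> [sf fle]; split=> // x; apply/cvgrPdist_lt => e e0.
near=> y; rewrite -(scalarB _ _ sf); apply: le_lt_trans (fle _) _.
by near: y; apply: cvgr_dist_lt.
Unshelve. all: by end_near. Qed.

Lemma dual_ballN f : dual_ball f -> dual_ball (fun x => - f x).
Proof.
move=> [sf fle]; split=> [a x y|x]; last by rewrite normrN.
by rewrite sf mulrN opprD.
Qed.

Lemma dual_scale_ball f : dual X f ->
  exists2 c : R, 0 < c & dual_ball (fun x => c * f x).
Proof.
move=> [sf cf]; have := cf 0 => /cvgrPdist_lt/(_ _ ltr01).
have f0 : f 0 = 0 by rewrite -(scaler0 _ 0) (scalarZl _ _ sf) mul0r.
rewrite f0 => /nbhs_normP[d /= d0 dP]; exists (d / 2); first by lra.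
split=> [a x y|x]; first by rewrite sf mulrDr mulrCA.
have [->|x0] := eqVneq x 0; first by rewrite f0 mulr0 !normr0.
have nx : 0 < `|x| by rewrite normr_gt0.
have := dP ((d / 2 / `|x|) *: x).
have dx0 : 0 < d / 2 / `|x| by rewrite !divr_gt0.
rewrite /ball_ /= !sub0r !normrN normrZ (scalarZl _ _ sf).
rewrite (gtr0_norm dx0) [`|_ * f x|]normrM (gtr0_norm dx0).
rewrite divfK ?gt_eqF // => /(_ ltac:(lra)) fx.
rewrite normrM gtr0_norm; last by lra.
by move: fx; rewrite mulrAC ltr_pdivrMr // mul1r; exact: ltW.
Qed.

End scalar_functions.
Arguments dual_ball {R} X.

Section bidual_elements.
Context {R : realType} {X : normedModType R}.
Variable Phi : (X -> R) -> R.
Hypothesis bPhi : bidual X Phi.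

(** The continuity constant of [Phi] may be taken positive, and the dual norm
    replaced by any bound on the unit ball. *)
Lemma bidual_bound : exists2 C : R, 0 < C & forall f r, dual X f ->
  (forall x, `|x| <= 1 -> `|f x| <= r) -> `|Phi f| <= C * r.
Proof.
have [_ [C CP]] := bPhi; exists (Num.max C 1); first by rewrite lt_max ltr01 orbT.
move=> f r df fr; rewrite -lee_fin; apply: le_trans (CP f df) _.
have r0 : 0 <= r by apply: le_trans (fr 0 _); rewrite ?normr0.
have dr : (dual_norm f <= r%:E)%E.
  by apply/ereal_supP => _ [x /= x1 <-]; rewrite lee_fin fr.
have d0 : (0 <= dual_norm f)%E.
  apply: le_trans (ereal_sup_ubound _); last by exists 0; rewrite /unit_ball /= ?normr0.
  by rewrite lee_fin.
rewrite EFinM; apply: (@le_trans _ _ ((Num.max C 1)%:E * dual_norm f)%E).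
  by apply: lee_wpmul2r => //; rewrite lee_fin le_max lexx.
by apply: lee_wpmul2l => //; rewrite lee_fin le_max ler01 orbT.
Qed.

Lemma bidual_sum (I : Type) (r : seq I) (a : I -> R) (f : I -> X -> R) :
  (forall i, dual X (f i)) ->
  dual X (fun x => \sum_(i <- r) a i * f i x) /\
  Phi (fun x => \sum_(i <- r) a i * f i x) = \sum_(i <- r) a i * Phi (f i).
Proof.
move=> df; have [PhiL _] := bPhi.
have d0 : dual X (fun=> 0).
  by split; [move=> a' x y; rewrite mulr0 addr0|exact: cst_continuous].
elim: r => [|i r [IHd IH]].
  have -> : (fun x : X => \sum_(i <- [::]) a i * f i x) = fun=> 0.
    by apply/funext => x; rewrite big_nil.
  split=> //; rewrite big_nil; have := PhiL 1 _ _ d0 d0.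
  have -> : (fun x : X => 1 * 0 + 0 : R) = fun=> 0.
    by apply/funext => x; rewrite mulr0 addr0.
  by rewrite mul1r => /eqP; rewrite addrC -subr_eq subrr => /eqP.
have -> : (fun x : X => \sum_(j <- i :: r) a j * f j x) =
          fun x => a i * f i x + (\sum_(j <- r) a j * f j x).
  by apply/funext => x; rewrite big_cons.
rewrite big_cons PhiL // IH; split=> //.
have [si ci] := df i; have [sr cr] := IHd.
split=> [b x y|x]; last first.
  by apply: cvgD; [apply: cvgM; [exact: cvg_cst|exact: ci]|exact: cr].
by rewrite si sr; ring.
Qed.

Lemma dual_ball_bidualN f : dual_ball X f -> Phi (fun x => - f x) = - Phi f.
Proof.
move=> /dual_ball_dual df; have [_] := bidual_sum [:: tt] (fun=> -1) (fun=> df).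
rewrite big_seq1 mulN1r => <-; congr Phi; apply/funext => x.
by rewrite big_seq1 mulN1r.
Qed.

(** Helly's theorem: an element of the bidual is approximated on finitely many
    functionals by an element of a fixed ball of the space. *)
Lemma helly : exists2 C : R, 0 < C &
  forall (I : finType) (f : I -> X -> R) (e : R),
  (forall i, dual_ball X (f i)) -> 0 < e ->
  exists2 x, `|x| <= C & forall i, `|Phi (f i) - f i x| < e.
Proof.
have [C C0 CP] := bidual_bound; exists C => // I f e fB e0.
pose v i := Phi (f i).
pose S x := \sum_i (v i - f i x) ^+ 2.
pose D := #|I|%:R * (C + C) ^+ 2 : R.
have D0 : 0 <= D by rewrite mulr_ge0 // sqr_ge0.
suff small t : 0 < t -> t <= 1 -> exists2 x, `|x| <= C & 2 * S x <= t * (1 + D).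
  pose t := Num.min 1 (e ^+ 2 / (1 + D)).
  have e2 : 0 < e ^+ 2 by rewrite exprn_gt0.
  have t0 : 0 < t by rewrite lt_min ltr01 divr_gt0 //; lra.
  have [|x xC Sx] := small t t0; first by rewrite ge_min lexx.
  have tD : t * (1 + D) <= e ^+ 2.
    by rewrite -ler_pdivlMr ?ge_min ?lexx ?orbT //; lra.
  exists x => // i; rewrite -(@ltr_pXn2r _ 2) // ?nnegrE ?ltW //.
  rewrite real_normK ?num_real //.
  have : (v i - f i x) ^+ 2 <= S x.
    by rewrite /S (bigD1 i) //= lerDl sumr_ge0 // => j _; exact: sqr_ge0.
  by have := sqr_ge0 (v i - f i x); move: tD Sx e2; rewrite /v; lra.
move=> t0 t1; pose E := [set S x | x in [set x | `|x| <= C]].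
have S0 x : 0 <= S x by rewrite sumr_ge0 // => i _; exact: sqr_ge0.
have hE : has_inf E.
  split; first by exists (S 0), 0 => //=; rewrite normr0 ltW.
  by exists 0 => _ [x _ <-].
(* [S x] is the squared Euclidean distance of [v] to the image of [x] in R^I:
   w is an approximate nearest point to v in the image of the ball, so that
   the functional g almost attains at w its supremum on the ball. *)
have [_ [w /= wC <-] wE] := inf_adherent (exprn_gt0 2 t0) hE.
pose a i := v i - f i w; pose g x := \sum_i a i * f i x.
have fS i : scalar (f i) by have [] := fB i.
have key u : `|u| <= C -> 2 * (g u - g w) <= t * (1 + D).
  move=> uC; pose b i := f i u - f i w.
  have bD : \sum_i b i ^+ 2 <= D.
    rewrite /D -sumr_const mulr_suml; apply: ler_sum => i _; rewrite mul1r.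
    rewrite -real_normK ?num_real // ler_pXn2r ?nnegrE ?addr_ge0 ?(ltW C0) //.
    rewrite /b -(scalarB _ _ (fS i)); have [_ fi] := fB i.
    apply: le_trans (fi _) _; by apply: le_trans (ler_normB _ _) _; exact: lerD.
  pose z := w + t *: (u - w).
  have zC : `|z| <= C.
    have -> : z = (1 - t) *: w + t *: u.
      by rewrite /z scalerBr scalerBl scale1r; rewrite addrA addrAC.
    apply: le_trans (ler_normD _ _) _; rewrite !normrZ !ger0_norm ?(ltW t0) ?subr_ge0 //.
    have : (1 - t) * `|w| <= (1 - t) * C by rewrite ler_wpM2l // subr_ge0.
    have : t * `|u| <= t * C by rewrite ler_wpM2l // ltW.
    by lra.
  have Sz : S z = S w - 2 * t * (g u - g w) + t ^+ 2 * \sum_i b i ^+ 2.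
    rewrite /S /g -sumrB !mulr_sumr -sumrN -!big_split /=; apply: eq_bigr => i _.
    have -> : f i z = t * b i + f i w by rewrite /z addrC fS (scalarB _ _ (fS i)).
    by rewrite /a /b; ring.
  have : inf E <= S z by apply: ge_inf; [exact: hE.2|exists z].
  have : t ^+ 2 * \sum_i b i ^+ 2 <= t ^+ 2 * D by rewrite ler_wpM2l // sqr_ge0.
  move=> h1 h2; rewrite -(ler_pM2l t0).
  have -> : t * (t * (1 + D)) = t ^+ 2 + t ^+ 2 * D by ring.
  have -> : t * (2 * (g u - g w)) = 2 * t * (g u - g w) by ring.
  by move: wE h1 h2; rewrite Sz; lra.
have [dg Phig] := bidual_sum (index_enum I) a (fun i => dual_ball_dual (fB i)).
have gw x : `|x| <= 1 -> `|g x| <= (g w + t * (1 + D) / 2) / C.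
  move=> x1; rewrite ler_pdivlMr // -{1}(gtr0_norm C0) -normrM ler_norml.
  have gZ c : g (c *: x) = c * g x by apply: scalarZl; exact: dg.1.
  have := key (C *: x); have := key (- C *: x).
  rewrite !gZ !normrZ normrN (gtr0_norm C0) ger_pMr //.
  by move=> /(_ x1) k1 /(_ x1) k2; apply/andP; split; lra.
have := CP _ _ dg gw; rewrite mulrC mulfVK ?gt_eqF // Phig => Pg.
exists w => //; have -> : S w = \sum_i a i * Phi (f i) - g w.
  by rewrite /g -sumrB; apply: eq_bigr => i _; rewrite -mulrBr -expr2.
by have := le_trans (ler_norm _) Pg; lra.
Qed.

End bidual_elements.

(** * Separated sequences in non-reflexive spaces *)

(** An element of the bidual outside a Banach space is at positive distance
    from it. *)
Lemma nonreflexive_far (R : realType) (X : completeNormedModType R)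
    (Phi : (X -> R) -> R) : bidual X Phi ->
  ~ (exists x, forall f, dual X f -> Phi f = f x) ->
  exists2 theta : R, 0 < theta &
    forall y, exists f, dual_ball X f /\ theta < Phi f - f y.
Proof.
move=> bPhi nPhi; apply: contrapT => nfar; apply: nPhi.
have [r [r0 rc]] : exists r : nat -> R, (forall n, 0 < r n) /\ r n @[n --> \oo] --> 0.
  by exists harmonic; split=> [n|]; [exact: harmonic_gt0|exact: cvg_harmonic].
have close n : exists y, forall f, dual_ball X f ->
    `|Phi f - f y| <= r n.
  apply: contrapT => nclose; apply: nfar; exists (r n) => // y.
  apply: contrapT => nf; apply: nclose; exists y => f fB.
  rewrite ler_norml; apply/andP; split; rewrite leNgt; apply/negP => ff.
    apply: nf; exists (fun x => - f x); split; first exact: dual_ballN.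
    by rewrite dual_ball_bidualN //=; lra.
  by apply: nf; exists f.
have [y yP] := choice close.
have y_dist n m : `|y n - y m| <= r n + r m.
  have [f [sf fle <-]] := norming_functional (y n - y m).
  have fB : dual_ball X f by [].
  rewrite (scalarB _ _ sf); have := yP n f fB; have := yP m f fB.
  by rewrite !ler_norml => /andP[? ?] /andP[? ?]; lra.
have inv_small (e : R) : 0 < e -> \forall n \near \oo, r n < e.
  move=> e0; have := rc => /cvgrPdist_lt/(_ e e0); apply: filterS.
  by move=> n; rewrite sub0r normrN gtr0_norm.
(* The approximations [y n] of [Phi] form a Cauchy sequence, whose limit
   represents [Phi]. *)
have yc : cvgn y.
  apply/cauchy_cvgP/cauchyP => e e0.
  have [N _ NP] := inv_small (e / 2) (divr_gt0 e0 (ltr0Sn _ 1)).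
  exists (y N); exists N => // n Nn; rewrite /= -ball_normE /=.
  apply: le_lt_trans (y_dist _ _) _.
  by have := NP _ (leqnn N); have := NP _ Nn; rewrite /=; lra.
exists (lim (y @ \oo)) => f df; have [c c0 cB] := dual_scale_ball df.
pose g x := c * f x.
suff Pg : Phi g = g (lim (y @ \oo)).
  apply: (mulfI (lt0r_neq0 c0)); rewrite -[RHS]Pg.
  have [_] := bidual_sum bPhi [:: tt] (fun=> c) (fun=> df).
  rewrite big_seq1 => <-; congr Phi; apply/funext => x.
  by rewrite big_seq1.
have gB : dual_ball X g by [].
apply/eqP; rewrite -subr_eq0 -normr_le0; apply/ler_addgt0Pr => e e0.
rewrite add0r.
have [N _ NP] := inv_small (e / 2) (divr_gt0 e0 (ltr0Sn _ 1)).
have /cvgrPdist_lt/(_ _ (divr_gt0 e0 (ltr0Sn _ 1))) [M _ MP] := yc.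
have h1 := NP _ (leq_maxl N M); have h2 := MP _ (leq_maxr N M).
have h3 := yP (maxn N M) g gB.
have := gB.2 (lim (y @ \oo) - y (maxn N M)).
rewrite (scalarB _ _ gB.1) => h4.
have -> : Phi g - g (lim (y @ \oo)) = (Phi g - g (y (maxn N M))) -
   (g (lim (y @ \oo)) - g (y (maxn N M))) by ring.
apply: le_trans (ler_normB _ _) _.
by move: h1 h2 h3 h4 => /=; lra.
Qed.

Lemma sorted_subseq_iota s n : sorted ltn s -> all (fun i => i < n)%N s ->
  subseq s (iota 0 n).
Proof.
move=> ss /allP sn; have -> : s = [seq i <- iota 0 n | i \in s].
  apply: (irr_sorted_eq ltn_trans ltnn) => //.
    by apply: sorted_filter; [exact: ltn_trans|exact: iota_ltn_sorted].
  move=> i; rewrite mem_filter mem_iota /= add0n.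
  by have [/sn ->|] := boolP (i \in s).
exact: filter_subseq.
Qed.

(** For any [2 k] increasing indices, the sums over the first [k] and over the
    last [k] of them are at distance at least [theta k]. *)
Definition separated (R : realType) (X : normedModType R) (theta : R)
    (x : nat -> X) : Prop :=
  forall k s, sorted ltn s -> size s = k.*2 ->
    theta * k%:R <=
    `|\sum_(i <- take k s) x i - \sum_(i <- drop k s) x i|.

(** James: the x_m are chosen so that, for each of the finitely many averages y
    of the previous terms, a functional separating [Phi] from y takes at x_m
    almost the same value as [Phi] does. *)
Lemma james_sequence (R : realType) (X : completeNormedModType R) :
  ~ reflexive_space X -> exists (theta : R) (x : nat -> X),
    [/\ 0 < theta, forall n, `|x n| <= 1 & separated theta x].
Proof.
move=> nX; have [Phi [bPhi nPhi]] : exists Phi, bidual X Phi /\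
    ~ (exists x, forall f, dual X f -> Phi f = f x).
  apply: contrapT => nP; apply: nX => Phi bPhi; apply: contrapT => nx.
  by apply: nP; exists Phi.
have [theta theta0 far] := nonreflexive_far bPhi nPhi.
have [F FP] := choice far.
have [C C0 CP] := helly bPhi.
pose avg (A : seq X) : X := (size A)%:R^-1 *: \sum_(y <- A) y.
have next (h : seq X) : exists x, `|x| <= C /\ forall A, subseq A h ->
    Phi (F (avg A)) - F (avg A) x < theta / 2.
  have [|x xC xP] := CP _ (fun m : (size h).-tuple bool => F (avg (mask m h)))
     (theta / 2) _ (divr_gt0 theta0 (ltr0Sn _ 1)).
    by move=> m; case: (FP (avg (mask m h))).
  exists x; split=> // A /subseqP[m mh ->].
  have /eqP mh' := mh; apply: le_lt_trans (ler_norm _) (xP (Tuple mh')).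
have [G /all_and2[GC GP]] := choice next.
pose hist := fix hist n := if n is m.+1 then rcons (hist m) (G (hist m)) else [::].
pose x n := G (hist n).
have histE n : hist n = map x (iota 0 n).
  by elim: n => [//|n IH]; rewrite -addn1 iotaD map_cat /= -IH addn1 cats1.
exists (theta / 2 / C), (fun n => C^-1 *: x n); split.
- by rewrite !divr_gt0.
- by move=> n; rewrite normrZ gtr0_norm ?invr_gt0 // ler_pdivrMl // mulr1 GC.
move=> k s ss sk; rewrite -!scaler_sumr -scalerBr normrZ gtr0_norm ?invr_gt0 //.
rewrite mulrAC mulrC ler_wpM2l ?invr_ge0 ?(ltW C0) //.
have [->|k0] := posnP k; first by rewrite mulr0.
have kR : 0 < k%:R :> R by rewrite ltr0n.
have tk : size (take k s) = k by rewrite size_takel // sk -addnn leq_addr.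
have dk : size (drop k s) = k by rewrite size_drop sk -addnn addnK.
pose A := map x (take k s).
have [[sf fle] fA] := FP (avg A); set f := F (avg A) in sf fle fA.
have fx j : j \in drop k s -> Phi f - theta / 2 <= f (x j).
  move=> js; suff /GP : subseq A (hist j) by rewrite -/f -/(x j); lra.
  rewrite histE; apply/map_subseq/sorted_subseq_iota; first exact: take_sorted.
  have := ss; rewrite -{1}(cat_take_drop k s) (sorted_pairwise ltn_trans).
  rewrite pairwise_cat => /andP[/allrelP lt_td _].
  by apply/allP => i it; exact: lt_td.
have fd : k%:R * (Phi f - theta / 2) <= f (\sum_(i <- drop k s) x i).
  rewrite (scalar_sum _ _ sf) -{1}dk -sum1_size natr_sum mulr_suml big_seq [leRHS]big_seq.
  by apply: ler_sum => j js; rewrite mul1r fx.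
have ft : f (\sum_(i <- take k s) x i) < k%:R * (Phi f - theta).
  have -> : \sum_(i <- take k s) x i = k%:R *: avg A.
    by rewrite /avg size_map tk scalerA mulfV ?gt_eqF // scale1r big_map.
  by rewrite (scalarZl _ _ sf) ltr_pM2l //; lra.
have := fle (\sum_(i <- take k s) x i - \sum_(i <- drop k s) x i).
rewrite (scalarB _ _ sf) ler_norml => /andP[h _]; move: h fd ft.
by rewrite !mulrBr; lra.
Qed.

(** * Alternating sums and almost isometric copies of l_1^n *)

(** The alternating sum [x s_0 - x s_1 + x s_2 - ...]. *)
Definition alt_sum (R : realType) (X : normedModType R) (x : nat -> X)
    (s : seq nat) : X := foldr (fun i z => x i - z) 0 s.

Section alternating_sums.
Context {R : realType} {X : normedModType R}.
Implicit Types (x : nat -> X) (s t : seq nat) (h : nat -> nat).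

Lemma alt_sum_map x h s : alt_sum x (map h s) = alt_sum (x \o h) s.
Proof. by elim: s => //= i s ->. Qed.

Lemma alt_sum_cat x s t : ~~ odd (size s) ->
  alt_sum x (s ++ t) = alt_sum x s + alt_sum x t.
Proof.
move=> es; suff -> : alt_sum x (s ++ t) =
    alt_sum x s + (-1) ^+ (odd (size s)) *: alt_sum x t.
  by rewrite (negbTE es) scale1r.
elim: s {es} => [|i s IH] /=; first by rewrite scale1r add0r.
rewrite IH opprD addrA.
by case: (odd _); rewrite /= ?expr0 ?expr1 ?scaleN1r ?scale1r ?opprK.
Qed.

Lemma norm_alt_sum x s : (forall i, `|x i| <= 1) ->
  `|alt_sum x s| <= (size s)%:R.
Proof.
move=> x1; elim: s => [|i s IH] /=; first by rewrite normr0.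
by apply: le_trans (ler_normB _ _) _; rewrite -natr1 addrC lerD.
Qed.

(** Up to two terms, an alternating sum over a block, or its negative, is the
    alternating sum over a subblock. *)
Lemma sign_alt_sum x (b : bool) a k : (forall i, `|x i| <= 1) ->
  `|(-1) ^+ b *: alt_sum x (iota a k.+1.*2)
    - alt_sum x (iota (a + (2 - b)) k.*2)| <= 2.
Proof.
move=> x1; have two (y z : X) : `|y| <= 1 -> `|z| <= 1 -> `|y - z| <= 2.
  by move=> y1 z1; apply: le_trans (ler_normB _ _) _; lra.
case: b; rewrite doubleS.
  have -> : (a + (2 - true) = a.+1)%N by rewrite addn1.
  rewrite -[k.*2.+1]addn1 /= iotaD alt_sum_cat; last first.
    by rewrite size_iota odd_double.
  rewrite /= subr0 scaleN1r opprB; set M := alt_sum _ _.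
  rewrite -addrA -opprD [x a + M]addrC opprD addrA [M + _]addrC addrK.
  exact: two.
have -> : (a + (2 - false) = a.+2)%N by rewrite addn2.
rewrite /= scale1r opprB addrA addrAC addrK.
exact: two.
Qed.

(** The combination is compared with the signed sum of the [u i], the signs
    being those of the [v i], multiplied by the largest [`|v i|]. *)
Lemma l1_lower_bound n (u : 'I_n -> X) (A B : R) : 0 <= B ->
  (forall i, `|u i| <= A) ->
  (forall b : 'I_n -> bool, n%:R * A - B <= `|\sum_i (-1) ^+ b i *: u i|) ->
  forall v : 'I_n -> R, (A - B) * (\sum_i `|v i|) <= `|\sum_i v i *: u i|.
Proof.
case: n u => [|n] u B0 uA signs v; first by rewrite !big_ord0 mulr0 normr0.
pose j := [arg max_(i > ord0) `|v i|]%O.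
have jmax i : `|v i| <= `|v j|.
  by rewrite /j; case: arg_maxP => // j' _ /(_ i isT).
pose mu : R := `|v j|; have mu0 : 0 <= mu by exact: normr_ge0.
have {}jmax i : `|v i| <= mu by exact: jmax.
pose b i := v i < 0.
have split_sum : \sum_i v i *: u i =
    mu *: (\sum_i (-1) ^+ b i *: u i) - \sum_i ((-1) ^+ b i * (mu - `|v i|)) *: u i.
  rewrite scaler_sumr -sumrB; apply: eq_bigr => i _; rewrite scalerA -scalerBl.
  congr (_ *: _); rewrite {1}[v i]numEsign -/(b i).
  by move: ((-1) ^+ _ : R) => s; ring.
have h1 : mu * (n.+1%:R * A - B) <= `|mu *: (\sum_i (-1) ^+ b i *: u i)|.
  by rewrite normrZ (ger0_norm mu0) ler_wpM2l.
have h2 : `|\sum_i ((-1) ^+ b i * (mu - `|v i|)) *: u i| <=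
    n.+1%:R * mu * A - A * \sum_i `|v i|.
  apply: le_trans (ler_norm_sum _ _ _) _.
  have -> : n.+1%:R * mu * A = \sum_(i < n.+1) mu * A.
    by rewrite sumr_const card_ord -[RHS]mulr_natl mulrA.
  rewrite mulr_sumr -sumrB.
  apply: ler_sum => i _; rewrite normrZ normrM normr_sign mul1r.
  rewrite ger0_norm ?subr_ge0 ?jmax // [A * _]mulrC -mulrBl.
  by rewrite ler_wpM2l ?subr_ge0 ?jmax.
have mu_le : mu <= \sum_i `|v i| by rewrite (bigD1 j) //= lerDl sumr_ge0.
have h3 : B * mu <= B * \sum_i `|v i| by rewrite ler_wpM2l.
rewrite split_sum; apply: le_trans (lerB_dist _ _).
by move: h1 h2 h3; rewrite !mulrBr !mulrBl; lra.
Qed.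

(** If every signed sum of the [u i] is almost as large as possible, then the
    [u i] span an almost isometric copy of l_1^n. *)
Lemma l1_copy n (u : 'I_n -> X) (A B e : R) : 0 < A -> 0 <= B -> 0 < e ->
  B * (1 + e) <= A * e ->
  (forall i, `|u i| <= A) ->
  (forall b : 'I_n -> bool, n%:R * A - B <= `|\sum_i (-1) ^+ b i *: u i|) ->
  contains_l1_copy X n (1 + e).
Proof.
move=> A0 B0 e0 Be uA signs; pose T (v : 'rV[R]_n) := \sum_i v ord0 i *: u i.
have Tlin : linear T.
  move=> a v w; rewrite /T scaler_sumr -big_split /=; apply: eq_bigr => i _.
  by rewrite !mxE scalerDl scalerA.
pose M := GRing.isLinear.Build R 'rV[R]_n X *:%R T Tlin.
pose F : {linear 'rV[R]_n -> X} := HB.pack T M.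
have AB : 0 < A - B.
  have : 0 < (A - B) * (1 + e) by lra.
  by rewrite pmulr_lgt0 //; lra.
exists F, A, (A - B)^-1; split.
- exact: ltW.
- by rewrite invr_ge0 ltW.
- by rewrite ler_pdivrMr //; lra.
- move=> v; rewrite /F /= /T /l1_norm; apply: le_trans (ler_norm_sum _ _ _) _.
  rewrite mulr_sumr; apply: ler_sum => i _.
  by rewrite normrZ mulrC ler_wpM2r.
- move=> v; rewrite ler_pdivlMl //.
  exact: (l1_lower_bound B0 uA signs (fun i => v ord0 i)).
Qed.

(** The union of [n] consecutive blocks of [2 k + 2] indices, deprived of their
    first two indices, or of the first and the last one when [b j] holds. *)
Definition trimmed (b : nat -> bool) (k n : nat) : seq nat :=
  flatten [seq iota (j * k.+1.*2 + (2 - b j)) k.*2 | j <- iota 0 n].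

Lemma trimmedS b k n : trimmed b k n.+1 =
  trimmed b k n ++ iota (n * k.+1.*2 + (2 - b n)) k.*2.
Proof. by rewrite /trimmed -[n.+1]addn1 iotaD map_cat flatten_cat /= cats0. Qed.

Lemma size_trimmed b k n : size (trimmed b k n) = (n * k).*2.
Proof.
elim: n => [//|n IH]; rewrite trimmedS size_cat IH size_iota.
by rewrite mulSn doubleD addnC.
Qed.

Lemma trimmed_sorted b k n : sorted ltn (trimmed b k n) /\
  all (fun i => i < n * k.+1.*2)%N (trimmed b k n).
Proof.
elim: n => [//|n [IHs /allP IHa]]; rewrite trimmedS; split.
  rewrite (sorted_pairwise ltn_trans) pairwise_cat -!(sorted_pairwise ltn_trans).
  rewrite IHs iota_ltn_sorted !andbT; apply/allrelP => i j /IHa ilt.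
  rewrite mem_iota => /andP[+ _]; apply: leq_trans; apply: leq_trans ilt _.
  exact: leq_addr.
rewrite all_cat; apply/andP; split; apply/allP => i.
  by move=> /IHa /leq_trans; apply; rewrite leq_mul2r leqnSn orbT.
rewrite mem_iota mulSn => /andP[_ /leq_trans]; apply.
by rewrite -addnA [(k.+1.*2 + _)%N]addnC leq_add2l doubleS
  -[k.*2.+2]addn2 [(k.*2 + 2)%N]addnC leq_add2r leq_subr.
Qed.

(* Keeps [/=] from unfolding the alternating sums over explicit blocks. *)
#[local] Arguments alt_sum : simpl never.

(** A signed sum of alternating sums over [n] consecutive blocks is, up to
    [2 n] terms, a single alternating sum. *)
Lemma sign_block_sum x (b : nat -> bool) k n : (forall i, `|x i| <= 1) ->
  `|\sum_(j < n) (-1) ^+ b j *: alt_sum x (iota (j * k.+1.*2) k.+1.*2)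
    - alt_sum x (trimmed b k n)| <= n.*2%:R.
Proof.
move=> x1; elim: n => [|n IH]; first by rewrite big_ord0 subrr normr0.
rewrite big_ord_recr /= trimmedS alt_sum_cat ?size_trimmed ?odd_double //.
rewrite opprD addrACA [n.+1.*2]doubleS -[n.*2.+2]addn2 natrD.
apply: le_trans (ler_normD _ _) _.
by apply: lerD IH _; exact: sign_alt_sum.
Qed.

End alternating_sums.

(** In a space without almost isometric copies of the l_1^n's, every sequence of
    the unit ball has, for some [k], a subsequence along which all the
    alternating sums of [2 k] terms are small compared with [k]. *)
Lemma small_alt_sums (R : realType) (X : normedModType R) (x : nat -> X)
    (e : R) : (forall i, `|x i| <= 1) -> ~ contains_l1ns X -> 0 < e ->
  exists k h, [/\ (0 < k)%N, incr h & forall s, sorted ltn s -> size s = k.*2 ->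
    `|alt_sum x (map h s)| <= e * k%:R].
Proof.
move=> x1 nl1 e0.
pose good (r : R) K := exists k h, [/\ (K <= k)%N, incr h &
  forall s, sorted ltn s -> size s = k.*2 -> `|alt_sum x (map h s)| <= r * k%:R].
pose G := [set r | forall K, good r K].
apply: contrapT => ne; apply: nl1 => n d n1 d0.
have ebad r : G r -> e <= r.
  move=> Gr; rewrite leNgt; apply/negP => re; apply: ne.
  have [k [h [k1 hi kP]]] := Gr 1%N; exists k, h; split=> // s ss sk.
  by apply: le_trans (kP s ss sk) _; rewrite ler_wpM2r // ltW.
have G2 : G 2.
  move=> K; exists K, id; split=> // s _ sk; rewrite map_id.
  by apply: le_trans (norm_alt_sum _ x1) _; rewrite sk -muln2 natrM mulrC.
have hG : has_inf G by split; [exists 2|exists e].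
(* [c] is the asymptotic value, per pair of terms, of the smallest bound for
   long alternating sums on a subsequence. *)
set c := inf G; have ec : e <= c by apply: lb_le_inf => //; exists 2.
have c0 : 0 < c by apply: lt_le_trans ec.
pose n' : R := n%:R; have n0 : 0 < n' by rewrite ltr0n.
have d1 : 0 < 1 + d by lra.
have [q q0 qE] : exists2 q, 0 < q & q * (1 + d) = d.
  by exists (d / (1 + d)); [exact: divr_gt0|rewrite divfK ?lt0r_neq0].
have qc0 : 0 < q * c by exact: mulr_gt0.
have n4 : 0 < 4 * n' by exact: mulr_gt0.
(* With blocks of [2 k] terms, the bounds [(c + dl) k] for the blocks and
   [(c - dl) n (k - 1) - 2 n] for their signed sums must differ by at most
   [q c k], after multiplication of the former by [n]; the choices of [dl] and
   of [L <= k] each account for half of this. *)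
have [dl dl0 ndl] : exists2 dl, 0 < dl & 4 * n' * dl = q * c.
  exists (q * c / (4 * n')); first exact: divr_gt0.
  by rewrite mulrC divfK ?lt0r_neq0.
have [r Gr rc] := inf_adherent dl0 hG; rewrite -/c in rc.
have [K0 low] : exists K, ~ good (c - dl) K.
  apply: contrapT => nK; have : c <= c - dl; last by lra.
  apply: ge_inf; first exact: hG.2.
  by move=> K; apply: contrapT => nb; apply: nK; exists K.
pose L := 2 * n' * (c + 2) / (q * c).
have [K1 LK1] : exists K1, L <= K1%:R.
  have L0 : 0 <= L by rewrite !mulr_ge0 ?invr_ge0 ?(ltW n0) ?(ltW qc0) //; lra.
  by exists (Num.bound L); apply/ltW/archi_boundP.
have [[|k] [h [kK hi up]]] := Gr (maxn K0 K1).+1; first by [].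
have [kK0 kK1] : (K0 <= k)%N /\ (K1 <= k)%N.
  by apply/andP; rewrite -geq_max -ltnS.
(* On a further subsequence, all alternating sums of length [2 n k] are
   large: otherwise Ramsey's theorem gives one on which all of them are at
   most [(c - dl) n k]. *)
have [g gi far] : exists2 g, incr g & forall s, sorted ltn s ->
    size s = (n * k).*2 -> (c - dl) * (n * k)%:R < `|alt_sum x (map (h \o g) s)|.
  have [g gi [small|large]] := ramsey (n * k).*2
      (fun s => `|alt_sum x (map h s)| <= (c - dl) * (n * k)%:R).
    case: low; exists (n * k)%N, (h \o g); split; last 2 first.
    - exact: incr_comp.
    - by move=> s ss sk; rewrite map_comp; exact: small.
    by apply: leq_trans kK0 _; rewrite leq_pmull.
  exists g => // s ss sk; rewrite ltNge map_comp; apply/negP; exact: large.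
pose y := x \o (h \o g); have y1 i : `|y i| <= 1 by exact: x1.
have hgi : incr (h \o g) by exact: incr_comp.
(* The blocks have [k.+1] pairs of terms, and the trimmed ones [k]. *)
pose kR : R := k.+1%:R.
have kR1 : 1 <= kR by rewrite ler1n.
pose A := (c + dl) * kR; pose B := n' * (2 * dl * kR + (c + 2)).
apply: (@l1_copy _ _ n (fun j => alt_sum y (iota (j * k.+1.*2) k.+1.*2)) A B).
- by rewrite mulr_gt0 //; lra.
- by rewrite mulr_ge0 ?addr_ge0 ?mulr_ge0 //; lra.
- exact: d0.
- have : L * (q * c) <= kR * (q * c).
    rewrite ler_wpM2r ?(ltW qc0) //.
    by apply: le_trans LK1 _; rewrite ler_nat ltnW.
  rewrite /L divfK ?lt0r_neq0 // => h1.
  have h2 : B <= q * c * kR.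
    rewrite /B; have : 4 * n' * dl * kR = q * c * kR by rewrite ndl.
    by move: h1; lra.
  have h3 : B * (1 + d) <= d * c * kR.
    have -> : d * c * kR = q * c * kR * (1 + d) by rewrite -{1}qE; ring.
    by rewrite ler_wpM2r // ltW.
  apply: le_trans h3 _; rewrite /A.
  have : 0 <= dl * kR * d by rewrite !mulr_ge0 ?(ltW dl0) ?(ltW d0) //; lra.
  by lra.
- move=> j; rewrite -alt_sum_map map_comp; apply: le_trans (up _ _ _) _.
  + by rewrite incr_sorted // iota_ltn_sorted.
  + by rewrite size_map size_iota.
  by rewrite ler_wpM2r // ltW.
move=> b; pose b' j := if insub j is Some i then b i else false.
have -> : \sum_(i < n) (-1) ^+ b i *: alt_sum y (iota (i * k.+1.*2) k.+1.*2) =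
    \sum_(i < n) (-1) ^+ b' i *: alt_sum y (iota (i * k.+1.*2) k.+1.*2).
  by apply: eq_bigr => i _; rewrite /b' valK.
have h1 := sign_block_sum b' k n y1.
have := far (trimmed b' k n) (proj1 (trimmed_sorted b' k n)) (size_trimmed b' k n).
rewrite alt_sum_map -/y => h2; set S := \sum_(i < n) _ in h1 *.
have h3 : `|alt_sum y (trimmed b' k n)| <= `|S| + `|S - alt_sum y (trimmed b' k n)|.
  have {1}-> : alt_sum y (trimmed b' k n) = S - (S - alt_sum y (trimmed b' k n)).
    by rewrite opprB addrC subrK.
  exact: ler_normB.
move: h1 h2; rewrite -muln2 !natrM -/n' => h1 h2.
have kE : k%:R = kR - 1 by rewrite /kR -natr1 addrK.
rewrite kE in h2.
have h4 : 0 <= n' * dl by rewrite mulr_ge0 ?ltW.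
by rewrite /A /B; move: h1 h2 h3 h4; lra.
Qed.

(** * Interlaced sums in upper stable spaces *)

Section interlacing.
Variable k : nat.

Lemma interlace_proof (s : 'I_(k + k)) :
  (match fintype.split s with inl i => i.*2 | inr j => j.*2.+1 end < k + k)%N.
Proof.
by case: fintype.split => i; rewrite addnn ?ltn_double // -doubleS leq_double.
Qed.

Definition interlace_fun (s : 'I_(k + k)) : 'I_(k + k) :=
  Ordinal (interlace_proof s).

Lemma interlace_inj : injective interlace_fun.
Proof.
move=> s t /(congr1 val) /= st; apply: (can_inj splitK).
case: (fintype.split s) (fintype.split t) st => i [] j st.
- by congr inl; apply/val_inj/double_inj.
- by have := congr1 odd st; rewrite /= !odd_double.
- by have := congr1 odd st; rewrite /= !odd_double.
- by congr inr; apply/val_inj/double_inj; case: st.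
Qed.

(** The permutation sending the first half of the indices to the even ones,
    the second half to the odd ones. *)
Definition interlace : 'S_(k + k) := perm interlace_inj.

Lemma interlaceL (i : 'I_k) : interlace (lshift k i) = i.*2 :> nat.
Proof. by rewrite permE /= -[lshift k i]/(unsplit (inl i)) unsplitK. Qed.

Lemma interlaceR (i : 'I_k) : interlace (rshift k i) = i.*2.+1 :> nat.
Proof. by rewrite permE /= -[rshift k i]/(unsplit (inr i)) unsplitK. Qed.

End interlacing.

Section stable_sums.
Context {R : realType} {X : normedModType R}.

Lemma alt_sum_nth (x : nat -> X) k s : size s = k.*2 ->
  alt_sum x s = \sum_(i < k) x (nth 0%N s i.*2)
              - \sum_(i < k) x (nth 0%N s i.*2.+1).
Proof.
elim: k s => [|k IH] s; first by move=> /size0nil ->; rewrite !big_ord0 subrr.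
case: s => [//|a [//|b s]] [sk]; rewrite !big_ord_recl /= (IH s sk).
set S0 := \sum_(i < k) _; set S1 := \sum_(i < k) _.
by rewrite opprB addrA opprD [RHS]addrACA [LHS]addrAC.
Qed.

Lemma take_tnth k (n : (k + k).-tuple nat) :
  take k n = [seq tnth n (lshift k i) | i <- enum 'I_k].
Proof.
apply: (@eq_from_nth _ 0%N).
  by rewrite size_takel !size_tuple ?card_ord ?leq_addr.
move=> i; rewrite size_takel ?size_tuple ?leq_addr // => ik.
rewrite nth_take // (nth_map (Ordinal ik)) ?size_enum_ord //.
by rewrite (tnth_nth 0%N) /= nth_enum_ord.
Qed.

Lemma drop_tnth k (n : (k + k).-tuple nat) :
  drop k n = [seq tnth n (rshift k i) | i <- enum 'I_k].
Proof.
apply: (@eq_from_nth _ 0%N).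
  by rewrite size_drop !size_tuple addnK card_ord.
move=> i; rewrite size_drop size_tuple addnK => ik.
rewrite nth_drop (nth_map (Ordinal ik)) ?size_enum_ord //.
by rewrite (tnth_nth 0%N) /= nth_enum_ord.
Qed.

(** The images under [F] of two sums of [k] terms, scaled by [c], are at
    distance at least [rho] for consecutive sums, and at most [w] for interlaced
    ones. The bound [r] only serves to make the maps bounded. *)
Lemma upper_stable_sums (Y : metricType R) (K : R) (F : X -> Y)
    (x : nat -> X) (k : nat) (c theta e r w rho : R) :
  0 < K -> K_upper_stable K Y -> (0 < k)%N -> 0 < c ->
  (forall i, `|x i| <= 1) -> separated theta x ->
  (forall s, sorted ltn s -> size s = k.*2 -> `|alt_sum x s| <= e * k%:R) ->
  (forall a b, `|a| <= c * k%:R -> `|b| <= c * k%:R -> mdist (F a) (F b) <= r) ->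
  (forall a b, `|a| <= c * k%:R -> `|b| <= c * k%:R ->
     `|a - b| <= c * (e * k%:R) -> mdist (F a) (F b) <= w) ->
  (forall a b, `|a| <= c * k%:R -> `|b| <= c * k%:R ->
     c * (theta * k%:R) <= `|a - b| -> rho <= mdist (F a) (F b)) ->
  rho <= K * w.
Proof.
move=> K0 stab k0 c0 x1 sepx altx Fbd Fnear Ffar.
pose a (n : k.-tuple nat) : X := c *: \sum_(i < k) x (tnth n i).
have aC n : `|a n| <= c * k%:R.
  rewrite normrZ gtr0_norm // ler_wpM2l ?(ltW c0) //.
  apply: le_trans (ler_norm_sum _ _ _) _.
  apply: (@le_trans _ _ (\sum_(i < k) 1)); first exact: ler_sum.
  by rewrite sumr_const card_ord.
have bdd : bounded_map_on (incr_tuples setT k) (F \o a).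
  by exists r => s t _ _; exact: Fbd.
have := @stab k k (interlace k) k0 _ _ (F \o a) (F \o a) bdd bdd setT infinite_nat.
rewrite -lee_fin EFinM => /(_ _ _) h.
apply: le_trans (le_trans (h _ _) _).
- apply/ereal_infP => _ [n [ns _] <-]; rewrite lee_fin.
  apply: Ffar => //; rewrite -scalerBr normrZ gtr0_norm // ler_wpM2l ?(ltW c0) //.
  have -> : \sum_(i < k) x (tnth [tuple tnth n (lshift k i0) | i0 < k] i) =
      \sum_(i <- take k n) x i.
    by rewrite take_tnth big_map big_enum; apply: eq_bigr => i _; rewrite tnth_mktuple.
  have -> : \sum_(i < k) x (tnth [tuple tnth n (rshift k i0) | i0 < k] i) =
      \sum_(i <- drop k n) x i.
    by rewrite drop_tnth big_map big_enum; apply: eq_bigr => i _; rewrite tnth_mktuple.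
  by apply: sepx => //; rewrite size_tuple addnn.
- by move=> i j ij; rewrite !interlaceL ltn_double.
- by move=> i j ij; rewrite !interlaceR ltnS ltn_double.
apply: lee_wpmul2l; first by rewrite lee_fin ltW.
apply/ereal_supP => _ [n [ns _] <-]; rewrite lee_fin.
apply: Fnear => //; rewrite -scalerBr normrZ gtr0_norm // ler_wpM2l ?(ltW c0) //.
have sn : size n = k.*2 by rewrite size_tuple addnn.
have := altx n ns sn; rewrite (alt_sum_nth _ sn).
under eq_bigr do rewrite -interlaceL -tnth_nth.
under [X in _ - X]eq_bigr do rewrite -interlaceR -tnth_nth.
under [X in _ -> `|X - _| <= _]eq_bigr do rewrite tnth_mktuple.
by under [X in _ -> `|_ - X| <= _]eq_bigr do rewrite tnth_mktuple.
Qed.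

End stable_sums.

(** * Coarse and uniform embeddings *)

Section moduli.
Context {R : realType} {X : normedModType R} {Y : metricType R}.
Implicit Types (D : set X) (phi : X -> Y).

Lemma expansion_le D phi t (w : R) : (expansion_modulus D phi t <= w%:E)%E ->
  forall a b, D a -> D b -> `|a - b| <= t -> mdist (phi a) (phi b) <= w.
Proof.
move=> ew a b Da Db ab; rewrite -lee_fin; apply: le_trans ew.
by apply: ereal_sup_ubound; exists (a, b).
Qed.

Lemma compression_ge D phi t (w : R) : (w%:E <= compression_modulus D phi t)%E ->
  forall a b, D a -> D b -> t <= `|a - b| -> w <= mdist (phi a) (phi b).
Proof.
move=> ew a b Da Db ab; rewrite -lee_fin; apply: le_trans ew _.
by apply: ereal_inf_lbound; exists (a, b).
Qed.

Lemma uniform_embedding_near D phi : uniform_embedding D phi ->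
  forall e : R, 0 < e -> exists2 d : R, 0 < d &
    forall a b, D a -> D b -> `|a - b| <= d -> mdist (phi a) (phi b) <= e.
Proof.
move=> [lim0 _] e e0.
have : \forall t \near (0 : R)^'+, (expansion_modulus D phi t < e%:E)%E.
  apply: (lim0 [set z | (z < e%:E)%E]); apply: open_nbhs_nbhs.
  by split; [exact: open_ereal_lt_ereal|rewrite /= lte_fin].
move=> near_e.
have [d [d0 dP]] : exists d : R, 0 < d /\ (expansion_modulus D phi d < e%:E)%E.
  have pos := nbhs_right_gt (0 : R).
  by have [d [? ?]] := filter_ex (filterI pos near_e); exists d.
by exists d => //; apply: expansion_le; exact: ltW.
Qed.

Lemma uniform_embedding_far D phi : uniform_embedding D phi ->
  forall t : R, 0 < t -> exists2 r : R, 0 < r &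
    forall a b, D a -> D b -> t <= `|a - b| -> r <= mdist (phi a) (phi b).
Proof.
move=> [_ +] t t0 => /(_ t t0); case E : (compression_modulus D phi t) => [r||] // r0.
  exists r; first by rewrite -lte_fin.
  by apply: compression_ge; rewrite E.
by exists 1 => //; apply: compression_ge; rewrite E leey.
Qed.

(** The point [phi a] is joined to [phi 0] by the images of [N] segments of
    length at most [d]. *)
Lemma unit_ball_image_bounded phi (d : R) : 0 < d ->
  (forall a b, unit_ball X a -> unit_ball X b -> `|a - b| <= d ->
     mdist (phi a) (phi b) <= 1) ->
  exists r : R, forall a b, unit_ball X a -> unit_ball X b ->
    mdist (phi a) (phi b) <= r.
Proof.
move=> d0 dP; pose N := (Num.bound d^-1).+1.
have N0 : 0 < N%:R :> R by rewrite ltr0n.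
have Nd : N%:R^-1 <= d.
  rewrite -[leRHS]invrK lef_pV2 ?posrE ?invr_gt0 //.
  apply: le_trans (ltW (archi_boundP _)) _; first by rewrite invr_ge0 ltW.
  by rewrite ler_nat.
have from0 a : unit_ball X a -> mdist (phi 0) (phi a) <= N%:R.
  move=> a1; suff chain i : (i <= N)%N ->
      mdist (phi 0) (phi ((i%:R / N%:R) *: a)) <= i%:R.
    by have := chain N (leqnn N); rewrite divff ?lt0r_neq0 // scale1r.
  elim: i => [|i IH] iN; first by rewrite mul0r scale0r mdistxx.
  apply: le_trans (metric_triangle _ (phi ((i%:R / N%:R) *: a)) _) _.
  rewrite -[leRHS]natr1; apply: lerD; first exact/IH/ltnW.
  have inball j : (j <= N)%N -> unit_ball X ((j%:R / N%:R) *: a).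
    move=> jN; rewrite /unit_ball /= normrZ ger0_norm ?divr_ge0 ?ler0n //.
    by rewrite -[leRHS]mulr1 ler_pM ?divr_ge0 // ler_pdivrMr // mul1r ler_nat.
  apply: dP; [exact/inball/ltnW|exact: inball|].
  rewrite -scalerBl -[i.+1%:R]natr1 mulrDl opprD addrA subrr add0r mul1r.
  rewrite normrZ normrN gtr0_norm ?invr_gt0 //; apply: le_trans Nd.
  by rewrite ger_pMr ?invr_gt0.
exists (N%:R + N%:R) => a b a1 b1.
apply: le_trans (metric_triangle _ (phi 0) _) _.
by apply: lerD; [rewrite metric_sym|]; exact: from0.
Qed.

End moduli.

Section no_embedding.
Context {R : realType} {X : normedModType R} (Y : metricType R).
Variables (K theta : R) (x : nat -> X).
Hypotheses (K0 : 0 < K) (stabY : K_upper_stable K Y) (theta0 : 0 < theta)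
  (x1 : forall i, `|x i| <= 1) (sepx : separated theta x)
  (nl1 : ~ contains_l1ns X).

Lemma separated_incr h : incr h -> separated theta (x \o h).
Proof.
move=> hi k s ss sk; have := sepx (k := k) (s := map h s).
rewrite incr_sorted // size_map -map_take -map_drop !big_map; exact.
Qed.

(** With [e = theta / T], the sums are scaled so that consecutive ones are at
    distance at least [T] and interlaced ones at distance at most 1. *)
Lemma no_coarse_embedding : ~ coarsely_embeds (setT : set X) Y.
Proof.
move=> [phi [comp exp]].
have expW t : 0 < t -> exists w : R, (expansion_modulus setT phi t <= w%:E)%E.
  move=> /exp; case: (expansion_modulus _ _ _) => [w||] // _; first by exists w.
  by exists 0; rewrite leNye.
have [w wP] := expW 1 ltr01.
have [T [T0 TP]] : exists T : R, 0 < T /\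
    ((K * w + 1)%:E <= compression_modulus setT phi T)%E.
  have big : \forall t \near +oo%R,
      ((K * w + 1)%:E <= compression_modulus setT phi t)%E.
    by move/cvgeyPge: comp; exact.
  by have [T [? ?]] := filter_ex (filterI (nbhs_pinfty_gt (num_real 0)) big); exists T.
have e0 : 0 < theta / T by exact: divr_gt0.
have [k [h [k0 hi small]]] := small_alt_sums x1 nl1 e0.
have kR : 0 < k%:R :> R by rewrite ltr0n.
pose c := (theta / T * k%:R)^-1; have c0 : 0 < c by rewrite invr_gt0 mulr_gt0.
have [r rP] := expW (c * k%:R + c * k%:R) (addr_gt0 (mulr_gt0 c0 kR) (mulr_gt0 c0 kR)).
suff : K * w + 1 <= K * w by lra.
apply: (@upper_stable_sums _ _ Y K phi (x \o h) k c theta (theta / T) r) => //.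
- by move=> i; exact: x1.
- exact: separated_incr.
- by move=> s ss sk; rewrite -alt_sum_map; exact: small.
- move=> a b ac bc; apply: (expansion_le rP) => //.
  by apply: le_trans (ler_normB _ _) _; exact: lerD.
- move=> a b _ _ ab; apply: (expansion_le wP) => //; apply: le_trans ab _.
  by rewrite mulVf // lt0r_neq0 // mulr_gt0.
- move=> a b _ _ ab; apply: (compression_ge TP) => //; apply: le_trans ab.
  by have -> : c * (theta * k%:R) = T by rewrite /c; field; rewrite !lt0r_neq0.
Qed.

(** Averages lie in the unit ball; consecutive ones are at distance at least
    [theta] and interlaced ones at distance at most [e]. *)
Lemma no_uniform_embedding D : unit_ball X `<=` D -> ~ uniformly_embeds D Y.
Proof.
move=> BD [phi uphi].
have [rho rho0 far] := uniform_embedding_far uphi theta0.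
have rK0 : 0 < rho / (2 * K) by rewrite divr_gt0 // mulr_gt0.
have [e e0 near_e] := uniform_embedding_near uphi rK0.
have [d d0 near_d] := uniform_embedding_near uphi ltr01.
have [r rP] : exists r : R, forall a b, unit_ball X a -> unit_ball X b ->
    mdist (phi a) (phi b) <= r.
  by apply: (unit_ball_image_bounded d0) => a b /BD Da /BD; exact: near_d.
have [k [h [k0 hi small]]] := small_alt_sums x1 nl1 e0.
have kR : k%:R != 0 :> R by rewrite pnatr_eq0 -lt0n.
have kc (z : R) : k%:R^-1 * (z * k%:R) = z by rewrite mulrCA mulVf // mulr1.
suff : rho <= K * (rho / (2 * K)).
  have -> : K * (rho / (2 * K)) = rho / 2 by field; rewrite lt0r_neq0.
  by lra.
apply: (@upper_stable_sums _ _ Y K phi (x \o h) k k%:R^-1 theta e r) => //.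
- by rewrite invr_gt0 ltr0n.
- by move=> i; exact: x1.
- exact: separated_incr.
- by move=> s ss sk; rewrite -alt_sum_map; exact: small.
- by rewrite mulVf.
- by rewrite mulVf // kc => a b /BD Da /BD Db; exact: near_e.
- by rewrite mulVf // kc => a b /BD Da /BD Db; exact: far.
Qed.

End no_embedding.

Theorem theorem18 (R : realType) (X : completeNormedModType R)
    (hX : ~ reflexive_space X)
    (hemb :
      (exists Y : metricType R, upper_stable Y /\
         (coarsely_embeds (setT : set X) Y \/
          uniformly_embeds (setT : set X) Y)) \/
      (exists Y : metricType R, upper_stable Y /\
         uniformly_embeds (unit_ball X) Y)) :
  contains_l1ns X.
Proof.
have [theta [x [theta0 x1 sepx]]] := james_sequence hX.
apply: contrapT => nl1.
case: hemb => [[Y [[K [K0 stabY]] [coarse|unif]]]|[Y [[K [K0 stabY]] unif]]].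
- exact: (no_coarse_embedding K0 stabY theta0 x1 sepx nl1 coarse).
- exact: (no_uniform_embedding K0 stabY theta0 x1 sepx nl1 (@subsetT _ _) unif).
- exact: (no_uniform_embedding K0 stabY theta0 x1 sepx nl1 (@subset_refl _ _) unif).
Qed.
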